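(* Let $\{s_i\}$ be the checks of a Pauli stabilizer code on qubits, let $L$ be a Pauli logical operator representative of this code, and let $G=(V,E)$ be a connected graph whose vertices are identified with the qubits in the support of $L$, with an arbitrarily chosen vertex $v_0\in V$. Then the gauging measurement procedure (defined in the context), applied to a code state $|\psi\rangle$, is equivalent to performing a projective measurement of $L$ on $|\psi\rangle$: it outputs $\sigma\in\{+1,-1\}$ with the probability $\|\tfrac12(\mathbb 1+\sigma L)|\psi\rangle\|^2$, together with the post-measurement code state $\tfrac12(\mathbb 1+\sigma L)|\psi\rangle$ (up to normalization and global phase).
   Context: A stabilizer code is the joint $+1$ eigenspace of a set of commuting Pauli operators (checks) $\{s_i\}$ generating a group not containing $-\mathbb 1$. A Pauli logical operator representative $L$ is a Pauli operator commuting with all checks. A basis is chosen for each qubit so that $L=\prod_{v\in \mathrm{supp}(L)}X_v$, i.e. $X_v$ denotes the Pauli factor of $L$ at qubit $v$. Gauging measurement procedure. Input: a normalized code state $|\psi\rangle$, the operator $L$, the connected graph $G=(V,E)$ with $V=\mathrm{supp}(L)$, and $v_0\in V$. 1. For each edge $e\in E$, adjoin an auxiliary qubit, also labelled $e$, in the state $|0\rangle_e$. 2. For each vertex $v\in V$, measure $A_v=X_v\prod_{e\ni v}X_e$ (these operators commute), obtaining $\varepsilon_v=\pm1$. Set $\sigma=\prod_{v\in V}\varepsilon_v$. 3. For each edge $e\in E$, measure $Z_e$, obtaining $\omega_e=\pm1$, and discard the edge qubit $e$. 4. For each vertex $v\in V$, pick an arbitrary edge-path $\gamma$ in $G$ from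 $v_0$ to $v$; if $\prod_{e\in\gamma}\omega_e=-1$, apply $X_v$ to the state. Output: $\sigma$ and the resulting state on the original qubits. *)

(* Defs.v *)
From HB Require Import structures.
From mathcomp Require Import all_boot all_order all_algebra.
Set Implicit Arguments.
Unset Strict Implicit.
Unset Printing Implicit Defensive.
Import Order.TTheory GRing.Theory Num.Theory.
Local Open Scope ring_scope.
Local Open Scope sesquilinear_scope.

(* The scalars are an arbitrary [C : numClosedFieldType], of which the complex
   numbers are an instance; [M ^t*] is the conjugate transpose.  The Hilbert
   space of a finite set [T] of qubits is ['cV[C]_(hdim T)]: its coordinates
   are indexed, through [label] and [index_of], by the computational basis labels
   [bits T]. *)
Notation bits T := {ffun T -> 'I_2}.

Definition hdim (T : finType) : nat := #|{: bits T}|.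

Definition label (T : finType) (i : 'I_(hdim T)) : bits T := enum_val i.

Definition index_of (T : finType) (x : bits T) : 'I_(hdim T) := enum_rank x.

Section Hilbert.
Variable C : numClosedFieldType.

(* Signs and measurement outcomes are booleans: [false] is +1, [true] is -1. *)
Definition sgn (b : bool) : C := (-1) ^+ b.

Definition norm2 n (psi : 'cV[C]_n) : C := \sum_i `|psi i 0| ^+ 2.

Definition density n (psi : 'cV[C]_n) : 'M[C]_n := psi *m psi ^t*.

Definition tensor (T : finType) (M : T -> 'M[C]_2) : 'M[C]_(hdim T) :=
  \matrix_(i, j) \prod_(q : T) M q (label i q) (label j q).

Definition site (T : finType) (q : T) (M : 'M[C]_2) : 'M[C]_(hdim T) :=
  tensor (fun p => if p == q then M else 1%:M).

End Hilbert.

Inductive pauli := PauliI | PauliX | PauliY | PauliZ.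

(* The operator i^phase times the tensor product of the factors. *)
Record pauli_op (Q : finType) := PauliOp {
  phase : 'I_4;
  factor : Q -> pauli
}.

Definition nontrivial (p : pauli) : bool := if p is PauliI then false else true.

Definition supp (Q : finType) (L : pauli_op Q) : {set Q} :=
  [set q | nontrivial (factor L q)].

Section Codes.
Variable C : numClosedFieldType.

Definition mxX : 'M[C]_2 := \matrix_(i, j) (i != j)%:R.
Definition mxZ : 'M[C]_2 := \matrix_(i, j) ((-1) ^+ i *+ (i == j)).

Definition pauli_mx (p : pauli) : 'M[C]_2 :=
  match p with
  | PauliI => 1%:M
  | PauliX => mxX
  | PauliY => 'i *: (mxX *m mxZ)
  | PauliZ => mxZ
  end.

Definition pauli_op_mx (Q : finType) (P : pauli_op Q) : 'M[C]_(hdim Q) :=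
  'i ^+ phase P *: tensor (fun q => pauli_mx (factor P q)).

Inductive generated n (S : 'M[C]_n -> Prop) : 'M[C]_n -> Prop :=
| generated1 : generated S 1%:M
| generated_in A : S A -> generated S A
| generatedM A B : generated S A -> generated S B -> generated S (A *m B)
| generatedV A : generated S A -> generated S (invmx A).

Definition stabilizer_checks (Q I : finType) (s : I -> pauli_op Q) : Prop :=
  (forall i j, comm_mx (pauli_op_mx (s i)) (pauli_op_mx (s j))) /\
  ~ generated (fun A => exists i, A = pauli_op_mx (s i)) (- 1%:M).

Definition code_vector (Q I : finType) (s : I -> pauli_op Q)
    (psi : 'cV[C]_(hdim Q)) : Prop :=
  forall i, pauli_op_mx (s i) *m psi = psi.

Definition logical_op (Q I : finType) (s : I -> pauli_op Q) (L : pauli_op Q) :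
    Prop :=
  forall i, comm_mx (pauli_op_mx L) (pauli_op_mx (s i)).

(* The X operator of one qubit with respect to the orthonormal basis given by
   the columns of the unitary [U]. *)
Definition basisX (U : 'M[C]_2) : 'M[C]_2 := U *m mxX *m U ^t*.

(* [U q] is a basis of qubit [q], and in these bases L is the product of the
   X_v over its support.  Such bases exist whenever L is Hermitian ([phase L]
   is 0 or 2) with nonempty support: each X_v is then plus or minus the Pauli
   factor of L at v, the product of these signs being the sign of L. *)
Definition adapted_basis (Q : finType) (L : pauli_op Q) (U : Q -> 'M[C]_2) :
    Prop :=
  (forall q, U q \is unitarymx) /\
  pauli_op_mx L = \prod_(v in supp L) site v (basisX (U v)).

End Codes.

(* The simple graph on [V] with set of edges [E], an edge being the set of its
   two end points. *)
Section Graphs.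
Variable V : finType.

Definition simple_graph (E : {set {set V}}) : Prop :=
  forall e, e \in E -> #|e| = 2.

Definition adjacent (E : {set {set V}}) : rel V :=
  fun u v => [set u; v] \in E.

Definition connected_graph (E : {set {set V}}) : Prop :=
  forall u v, connect (adjacent E) u v.

Definition edge (E : {set {set V}}) : finType := {e : {set V} | e \in E}.

Fixpoint edge_path (E : {set {set V}}) (u : V) (g : seq (edge E)) (w : V) :
    bool :=
  if g is e :: g' then
    [exists u' : V, (val e == [set u; u']) && edge_path u' g' w]
  else u == w.

End Graphs.

Definition vertex (Q : finType) (L : pauli_op Q) : finType :=
  {q : Q | q \in supp L}.

(* States are represented by unnormalized density matrices: a sequence of
   measurement outcomes occurs with probability the trace of the matrix that it
   produces, and the resulting state is that matrix divided by its trace. *)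
Section Procedure.
Variable C : numClosedFieldType.

Definition conjugate n (M rho : 'M[C]_n) : 'M[C]_n := M *m rho *m M ^t*.

Definition eigenproj n (A : 'M[C]_n) (b : bool) : 'M[C]_n :=
  2^-1 *: (1%:M + sgn C b *: A).

Definition measure n (A : 'M[C]_n) (b : bool) (rho : 'M[C]_n) : 'M[C]_n :=
  conjugate (eigenproj A b) rho.

Definition measure_seq n (K : Type) (A : K -> 'M[C]_n) (ks : seq K)
    (o : K -> bool) (rho : 'M[C]_n) : 'M[C]_n :=
  foldl (fun r k => measure (A k) (o k) r) rho ks.

Definition adjoin0 (Q T : finType) (psi : 'cV[C]_(hdim Q)) :
    'cV[C]_(hdim (Q + T)%type) :=
  \col_i (psi (index_of [ffun q => label i (inl q)]) 0
          * [forall t : T, label i (inr t) == 0]%:R).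

Definition join_bits (Q T : finType) (x : bits Q) (z : bits T) :
    bits (Q + T)%type :=
  [ffun a => match a with inl q => x q | inr t => z t end].

(* The partial trace over the qubits of [T]. *)
Definition discard (Q T : finType) (rho : 'M[C]_(hdim (Q + T)%type)) :
    'M[C]_(hdim Q) :=
  \matrix_(i, j) \sum_(z : bits T)
    rho (index_of (join_bits (label i) z))
        (index_of (join_bits (label j) z)).

Variables (Q : finType) (L : pauli_op Q) (U : Q -> 'M[C]_2).
Variable E : {set {set vertex L}}.

Definition gaugeA (v : vertex L) : 'M[C]_(hdim (Q + edge E)%type) :=
  site (inl (val v)) (basisX (U (val v)))
    *m \prod_(e : edge E | v \in val e) site (inr e) (mxX C).

Definition edgeZ (e : edge E) : 'M[C]_(hdim (Q + edge E)%type) :=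
  site (inr e) (mxZ C).

(* [gamma v] is the edge-path picked for [v]. *)
Definition correct (ws : seq (vertex L)) (omega : {ffun edge E -> bool})
    (gamma : vertex L -> seq (edge E)) (rho : 'M[C]_(hdim Q)) :
    'M[C]_(hdim Q) :=
  foldl (fun r v =>
      if \prod_(e <- gamma v) sgn C (omega e) == -1
      then conjugate (site (val v) (basisX (U (val v)))) r else r) rho ws.

(* The unnormalized output state for the outcomes [eps] of the A_v and [omega]
   of the Z_e; [vs], [es] and [ws] are the orders in which the A_v are
   measured, the Z_e are measured and the corrections are applied. *)
Definition gauging_output (vs ws : seq (vertex L)) (es : seq (edge E))
    (psi : 'cV[C]_(hdim Q))
    (eps : {ffun vertex L -> bool}) (omega : {ffun edge E -> bool})
    (gamma : vertex L -> seq (edge E)) : 'M[C]_(hdim Q) :=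
  let rho0 := density (adjoin0 (edge E) psi) in
  let rho1 := measure_seq gaugeA vs eps rho0 in
  let rho2 := measure_seq edgeZ es omega rho1 in
  correct ws omega gamma (discard rho2).

Definition gauging_sign (eps : {ffun vertex L -> bool}) : C :=
  \prod_(v : vertex L) sgn C (eps v).

End Procedure.

(* Main.v *)
(* Multiplying out the projectors of the A_v gives a sum over c in F_2^V of
   eps^c X(c) (x) X_E(delta c), where X(c) is the product of the X_v with
   c v = 1 and delta is the coboundary map of G.  Applied to psi (x) |0>, the
   outcomes omega of the Z_e keep only the c with delta c = omega.  As G is
   connected, these are either absent, so that omega has probability 0, or some
   c and its complement, and X(complement of c) = X(c) L; thus the state is
   proportional to X(c) (1 + sigma L) psi.  The corrections apply X(c) or
   X(complement of c), which removes X(c) up to L, and L acts on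
   (1 + sigma L) psi by the sign sigma.  All 2^(|V|-1) * 2^(|V|-1) pairs
   (eps, omega) with sign sigma and omega a coboundary are equally likely. *)
Require Import Defs.
From HB Require Import structures.
From mathcomp Require Import all_boot all_order all_algebra.
From mathcomp Require Import ring.
Set Implicit Arguments.
Unset Strict Implicit.
Unset Printing Implicit Defensive.
Import Order.TTheory GRing.Theory Num.Theory.
Local Open Scope ring_scope.

Section Lemmas.
Local Open Scope sesquilinear_scope.

(** * Algebra of tensor products of one-qubit operators *)

Section Tensor.
Context (C : numClosedFieldType) (T : finType).
Implicit Types M N : T -> 'M[C]_2.

Lemma labelK : cancel (@label T) (@index_of T).
Proof. exact: enum_valK. Qed.

Lemma index_ofK : cancel (@index_of T) (@label T).
Proof. exact: enum_rankK. Qed.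

Lemma index_of_bij (P : pred 'I_(hdim T)) : {on P, bijective (@index_of T)}.
Proof. exact/onW_bij/(Bijective index_ofK labelK). Qed.

Lemma eq_tensor M N : M =1 N -> tensor M = tensor N.
Proof.
move=> eMN; apply/matrixP=> i j; rewrite !mxE.
by apply: eq_bigr => q _; rewrite eMN.
Qed.

(** Distributing the product over qubits of sums over one intermediate bit gives a single sum over
    all intermediate labels. *)
Lemma tensorM M N : tensor M * tensor N = tensor (fun q => M q * N q).
Proof.
apply/matrixP=> i j; rewrite !mxE (reindex _ (index_of_bij _)) /=.
under [RHS]eq_bigr do rewrite mxE.
rewrite bigA_distr_bigA; apply: eq_bigr => f _.
by rewrite !mxE -big_split /= index_ofK.
Qed.

Lemma tensor1 : tensor (fun _ : T => 1) = 1 :> 'M[C]_(hdim T).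
Proof.
apply/matrixP=> i j; rewrite !mxE.
have [->|neq_ij] := eqVneq i j.
  by rewrite big1 // => q _; rewrite mxE eqxx.
have /existsP[q neq_q] : [exists q, label i q != label j q].
  apply: contraNT neq_ij => /existsPn eq_l.
  apply/eqP/(can_inj labelK)/ffunP => q; apply/eqP/negPn/eq_l.
by rewrite (bigD1 q) //= mxE (negPf neq_q) mul0r.
Qed.

Lemma tensor_prod K (r : seq K) (M : K -> T -> 'M[C]_2) :
  \prod_(k <- r) tensor (M k) = tensor (fun q => \prod_(k <- r) M k q).
Proof.
elim: r => [|k r IHr].
  by rewrite big_nil -tensor1; apply: eq_tensor => q; rewrite big_nil.
by rewrite big_cons IHr tensorM; apply: eq_tensor => q; rewrite big_cons.
Qed.

Lemma siteE (q : T) (M : 'M[C]_2) i j :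
  site q M i j =
    M (label i q) (label j q) * \prod_(p | p != q) (label i p == label j p)%:R.
Proof.
rewrite mxE (bigD1 q) //= eqxx; congr (_ * _).
by apply: eq_bigr => p /negPf ->; rewrite mxE.
Qed.

Lemma site_is_linear (q : T) : linear (@site C T q).
Proof.
move=> a M N; apply/matrixP => i j.
have linE n (A B : 'M[C]_n) x y : (a *: A + B) x y = a * A x y + B x y.
  by rewrite !mxE.
by rewrite siteE !linE !siteE mulrDl mulrA.
Qed.

HB.instance Definition _ (q : T) :=
  GRing.isLinear.Build C 'M[C]_2 'M[C]_(hdim T) _ (@site C T q)
    (site_is_linear q).

Lemma site1 (q : T) : site q 1%:M = 1%:M :> 'M[C]_(hdim T).
Proof. by rewrite -[RHS]tensor1; apply: eq_tensor => p; case: ifP. Qed.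

Lemma eigenproj_site (q : T) (A : 'M[C]_2) b :
  eigenproj (site q A) b = site q (eigenproj A b).
Proof.
by rewrite /eigenproj [RHS]linearZ [in RHS]linearD [in RHS]linearZ /= site1.
Qed.

End Tensor.

(** * Products of commuting operators *)

Lemma big_perm_comm (R : pzSemiRingType) (K : eqType) (F : K -> R)
    (r1 r2 : seq K) :
  (forall i j, GRing.comm (F i) (F j)) -> perm_eq r1 r2 ->
  \prod_(i <- r1) F i = \prod_(i <- r2) F i.
Proof.
move=> cF; elim: r1 r2 => [|i r1 IHr] r2 eq_r.
  by move: eq_r; rewrite perm_sym => /perm_nilP ->.
have ir2 : i \in r2 by rewrite -(perm_mem eq_r) mem_head.
(* The head of [r1] is located inside [r2] and will be moved to the front past the prefix [a]. *)
case/splitPr: ir2 eq_r => a b eq_r.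
rewrite big_cat !big_cons (IHr (a ++ b)); last first.
  rewrite -(perm_cons i) (perm_trans eq_r) // perm_catC /=.
  by rewrite perm_cons perm_catC.
rewrite big_cat mulrA [RHS]mulrA; congr (_ * _).
by apply: commr_prod => j _; apply: cF.
Qed.

Lemma scaler_mull (R : comPzRingType) n (a : R) (M N : 'M[R]_n) :
  (a *: M) * N = a *: (M * N).
Proof. exact/esym/scalemxAl. Qed.

Lemma scaler_mulr (R : comPzRingType) n (a : R) (M N : 'M[R]_n) :
  M * (a *: N) = a *: (M * N).
Proof. exact/esym/scalemxAr. Qed.

Lemma comm_eigenproj (C : numClosedFieldType) n (A M : 'M[C]_n) b :
  GRing.comm M A -> GRing.comm M (eigenproj A b).
Proof.
have commZ a (N : 'M[C]_n) : GRing.comm M N -> GRing.comm M (a *: N).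
  by rewrite /GRing.comm scaler_mull scaler_mulr => ->.
by move=> cA; apply/commZ/commrD/commZ/cA/commr1.
Qed.

(** * Products of powers of fixed one-qubit operators *)

Section PowTensor.
Context (C : numClosedFieldType) (T : finType) (B : T -> 'M[C]_2).

(** Operators are encoded by exponents, so that multiplying them adds exponents; when each [B q] is
    an involution, only parities matter. *)
Definition pow_tensor (n : T -> nat) : 'M[C]_(hdim T) :=
  tensor (fun q => B q ^+ n q).

Lemma eq_pow_tensor n1 n2 : n1 =1 n2 -> pow_tensor n1 = pow_tensor n2.
Proof. by move=> en; apply: eq_tensor => q; rewrite en. Qed.

Lemma pow_tensorM n1 n2 :
  pow_tensor n1 * pow_tensor n2 = pow_tensor (fun q => n1 q + n2 q)%N.
Proof. by rewrite tensorM; apply: eq_tensor => q; rewrite exprD. Qed.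

Lemma pow_tensor_prod K (r : seq K) (P : pred K) (n : K -> T -> nat) :
  \prod_(k <- r | P k) pow_tensor (n k) =
  pow_tensor (fun q => \sum_(k <- r | P k) n k q)%N.
Proof.
rewrite -big_filter tensor_prod; apply: eq_tensor => q.
by rewrite expr_sum big_filter.
Qed.

Lemma pow_tensorX n (b : bool) :
  pow_tensor n ^+ b = pow_tensor (fun q => b * n q)%N.
Proof.
case: b => /=; last by rewrite expr0 -tensor1; apply: eq_tensor.
by rewrite expr1; apply: eq_pow_tensor => q; rewrite mul1n.
Qed.

Lemma eq_odd_pow_tensor n1 n2 :
  (forall q, B q * B q = 1) -> (forall q, odd (n1 q) = odd (n2 q)) ->
  pow_tensor n1 = pow_tensor n2.
Proof.
move=> B2 en; apply: eq_tensor => q.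
have powE n : B q ^+ n = B q ^+ odd n.
  by rewrite -{1}[n]odd_double_half exprD -mul2n exprM expr2 B2 expr1n mulr1.
by rewrite powE en -powE.
Qed.

Lemma site_pow_tensor (q : T) n :
  site q (B q ^+ n) = pow_tensor (fun p => (p == q) * n)%N.
Proof.
by apply: eq_tensor => p; case: eqP => [->|_]; rewrite ?mul1n // mul0n.
Qed.

(** Each projector has two terms, indexed by a bit. The [A k] commute, so the factors can be put in
    canonical order and the product distributed into a sum over bit assignments [c]. *)
Lemma prod_eigenproj (K : finType) (r : seq K) (n : K -> T -> nat)
    (A : K -> 'M[C]_(hdim T)) (o : K -> bool) :
  (forall k, A k = pow_tensor (n k)) -> perm_eq r (enum K) ->
  \prod_(k <- r) eigenproj (A k) (o k) =
  2^-1 ^+ #|K| *: \sum_(c : {ffun K -> bool}) (\prod_k sgn C (o k && c k))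
     *: pow_tensor (fun q => \sum_k c k * n k q)%N.
Proof.
move=> AE eq_r.
have eq_ri : perm_eq r (index_enum K).
  apply: perm_trans eq_r (uniq_perm (enum_uniq _) (index_enum_uniq _) _) => k.
  by rewrite mem_enum mem_index_enum.
have cA i j : GRing.comm (A i) (A j).
  rewrite !AE /GRing.comm !pow_tensorM.
  by apply: eq_pow_tensor => q; rewrite addnC.
rewrite (big_perm_comm _ eq_ri); last first.
  by move=> i j; apply/comm_eigenproj/commr_sym/comm_eigenproj/commr_sym/cA.
(* The term of the projector that contains [A k] to the power [b]. *)
pose F k (b : bool) :=
  (2^-1 * sgn C (o k && b)) *: pow_tensor (fun q => b * n k q)%N.
have -> : \prod_k eigenproj (A k) (o k) = \prod_(k : K) \sum_b F k b.
  apply: eq_bigr => k _.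
  rewrite big_bool /F -!pow_tensorX expr0 expr1 AE andbF andbT /eigenproj.
  by rewrite scalerDr addrC scalerA mulr1.
rewrite bigA_distr_bigA scaler_sumr; apply: eq_bigr => c _.
have scale_prod (s : seq K) a (M : K -> 'M[C]_(hdim T)) :
    \prod_(k <- s) (a k *: M k) = (\prod_(k <- s) a k) *: \prod_(k <- s) M k.
  elim: s => [|k s IHs]; first by rewrite !big_nil scale1r.
  by rewrite !big_cons IHs scaler_mull scaler_mulr scalerA.
rewrite /F scale_prod big_split prodr_const scalerA.
by rewrite pow_tensor_prod.
Qed.

End PowTensor.

(** * Pure states under conjugation and measurement *)

Section States.
Context (C : numClosedFieldType).

Lemma conjugate_density n (M : 'M[C]_n) (psi : 'cV[C]_n) :
  conjugate M (density psi) = density (M *m psi).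
Proof. by rewrite /conjugate /density trmx_mul map_mxM !mulmxA. Qed.

Lemma densityZ n a (psi : 'cV[C]_n) :
  density (a *: psi) = (`|a| ^+ 2) *: density psi.
Proof.
by rewrite /density linearZ /= map_mxZ -scalemxAl -scalemxAr scalerA normCK.
Qed.

Lemma trace_density n (psi : 'cV[C]_n) : \tr (density psi) = norm2 psi.
Proof.
by apply: eq_bigr => i _; rewrite mxE big_ord1 !mxE normCK.
Qed.

(** The list is reversed because the operator applied last stands leftmost in the product. *)
Lemma foldl_conjugate n K (F : K -> 'M[C]_n) (r : seq K) (psi : 'cV[C]_n) :
  foldl (fun rho k => conjugate (F k) rho) (density psi) r
    = density ((\prod_(k <- rev r) F k) *m psi).
Proof.
elim: r psi => [|k r IHr] psi /=; first by rewrite big_nil mul1mx.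
by rewrite conjugate_density IHr rev_cons -cats1 big_cat big_seq1 mulmxA.
Qed.

Lemma measure_seq_density n K (A : K -> 'M[C]_n) (r : seq K) o
    (psi : 'cV[C]_n) :
  measure_seq A r o (density psi)
    = density ((\prod_(k <- rev r) eigenproj (A k) (o k)) *m psi).
Proof. exact: foldl_conjugate. Qed.

(** * Adjoining and discarding auxiliary qubits *)

Section Ancilla.
Context (Q T : finType).
Implicit Types (x y : bits Q) (z w : bits T).

Lemma join_bits_bij :
  bijective (fun p : bits Q * bits T => index_of (join_bits p.1 p.2)).
Proof.
pose g (i : 'I_(hdim (Q + T)%type)) : bits Q * bits T :=
  ([ffun q => label i (inl q)], [ffun t => label i (inr t)]).
exists g => [[x z]|i]; rewrite /g ?index_ofK /=.
  by congr pair; apply/ffunP => q; rewrite !ffunE.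
rewrite -[RHS]labelK; congr index_of.
by apply/ffunP => -[q|t]; rewrite !ffunE.
Qed.

Lemma tensor_adjoin0 (M : Q + T -> 'M[C]_2) (psi : 'cV[C]_(hdim Q)) x z :
  (tensor M *m adjoin0 T psi) (index_of (join_bits x z)) 0
    = (tensor (fun q => M (inl q)) *m psi) (index_of x) 0
      * \prod_t M (inr t) (z t) 0.
Proof.
rewrite !mxE (reindex _ (onW_bij _ join_bits_bij)) /=.
rewrite -(pair_bigA _ (fun y w =>
  tensor M (index_of (join_bits x z)) (index_of (join_bits y w))
  * adjoin0 T psi (index_of (join_bits y w)) 0)) /=.
rewrite [in RHS](reindex _ (index_of_bij _)) mulr_suml.
apply: eq_bigr => y _ /=.
(* The auxiliary qubits start in the all-zero state, so only the label [w = 0] contributes; this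
   selects column 0 of each auxiliary factor. *)
rewrite (bigD1 [ffun=> 0]) //= [X in _ + X]big1 ?addr0 => [|w w0].
  rewrite !mxE !index_ofK big_sumType /= (_ : [forall t, _] = true); last first.
    by apply/forallP => t; rewrite !ffunE.
  rewrite mulr1 mulrAC; congr (_ * _ * _).
  - by apply: eq_bigr => q _; rewrite !ffunE.
  - by congr (psi (index_of _) 0); apply/ffunP => q; rewrite !ffunE.
  - by apply: eq_bigr => t _; rewrite !ffunE.
rewrite !mxE !index_ofK (_ : [forall t, _] = false) ?mulr0 //.
apply: contraNF w0 => /forallP w0; apply/eqP/ffunP => t.
by apply/eqP; have := w0 t; rewrite !ffunE.
Qed.

(** The hypothesis says that [Psi] is the product of [psi] with the basis state [z]; only the term
    [z] of the partial trace survives, so the state stays pure. *)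
Lemma discard_density (psi : 'cV[C]_(hdim Q))
    (Psi : 'cV[C]_(hdim (Q + T)%type)) z :
  (forall x w, Psi (index_of (join_bits x w)) 0
     = psi (index_of x) 0 * (w == z)%:R) ->
  discard (density Psi) = density psi.
Proof.
move=> PsiE; apply/matrixP => i j; rewrite !mxE big_ord1 (bigD1 z) //=.
rewrite big1 => [|w /negPf wz].
  by rewrite !mxE big_ord1 !mxE !PsiE !labelK eqxx !mulr1 addr0.
by rewrite !mxE big_ord1 !mxE !PsiE wz mulr0 mul0r.
Qed.

End Ancilla.

Lemma eigenprojZE b (i j : 'I_2) :
  eigenproj (mxZ C) b i j = ((i == j) && (i == b :> nat))%:R.
Proof.
have h2 : 2^-1 * (1 + 1) = 1 :> C by rewrite -[1 + 1]/(2%:R) mulVf ?pnatr_eq0.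
rewrite !mxE; case: eqVneq => [->|_] /=; last by rewrite !mulr0n mulr0 addr0 mulr0.
by case: b j => [] [[|[]] //= ltj];
  rewrite /sgn !mulr1n ?expr0 ?expr1 ?mulr1 ?mul1r ?mulN1r ?opprK ?subrr ?mulr0.
Qed.

Lemma mxX_sqr : mxX C * mxX C = 1.
Proof.
apply/matrixP => i j; rewrite !mxE !big_ord_recl big_ord0 !mxE.
by case: i j => [[|[]] //= lti] [[|[]] //= ltj];
  rewrite ?(mulr0, mul0r, mulr1, addr0, add0r).
Qed.

(** As X is an involution, only the parity of [n] counts; this is where the mod 2 coboundary arises
    on an edge qubit. *)
Lemma mxX_expE n (i : 'I_2) : (mxX C ^+ n) i 0 = (i == odd n :> nat)%:R.
Proof.
rewrite -{1}[n]odd_double_half exprD -mul2n exprM expr2 mxX_sqr expr1n mulr1.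
by case: (odd n); rewrite ?expr1 ?expr0 mxE; case: i => [[|[]]].
Qed.

Lemma basisX_sqr (U : 'M[C]_2) : U \is unitarymx -> basisX U * basisX U = 1.
Proof.
move=> /unitarymxP UU; have UU' := mulmx1C UU.
have XX : mxX C *m mxX C = 1%:M := mxX_sqr.
rewrite /basisX /GRing.mul /= !mulmxA -(mulmxA _ _ U) UU' mulmx1.
by rewrite -(mulmxA U) XX mulmx1.
Qed.

End States.

(** * Sums and products of truth values *)

Lemma sum_eq_pred (T : finType) (P : pred T) (x : T) :
  (\sum_(k | P k) (x == k) = P x)%N.
Proof.
rewrite big_mkcond (bigD1 x) //= eqxx big1 ?addn0 => [|k /negPf xk].
  by case: (P x).
by rewrite eq_sym xk if_same.
Qed.

Lemma prodr_bool (R : comPzSemiRingType) (T : finType) (b : pred T) :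
  \prod_t (b t)%:R = [forall t, b t]%:R :> R.
Proof.
case: forallP => [bT|/forallP]; first by rewrite big1 // => t _; rewrite bT.
by rewrite negb_forall => /existsP[t /negPf bt]; rewrite (bigD1 t) //= bt mul0r.
Qed.

(** * The state after measuring the gauge operators and the edges *)

Section Gauging.
Context (C : numClosedFieldType) (Q : finType) (L : pauli_op Q).
Context (U : Q -> 'M[C]_2) (E : {set {set vertex L}}).
Context (hU : adapted_basis L U).
Implicit Types (c eps : {ffun vertex L -> bool}).
Implicit Types (omega : {ffun edge E -> bool}).

(* The operator X(c) of the header. *)
Definition vertexX c : 'M[C]_(hdim Q) :=
  pow_tensor (fun q => basisX (U q)) (fun q => \sum_v c v * (q == val v))%N.

(** The parity runs over all vertices of [e], to match the exponent of X at [e] in a product of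
    gauge operators; [coboundaryE] reduces it to the two end points. *)
Definition coboundary c : {ffun edge E -> bool} :=
  [ffun e : edge E => odd (\sum_v c v * (v \in val e))%N].

Definition gauge_basis (a : Q + edge E) : 'M[C]_2 :=
  if a is inl q then basisX (U q) else mxX C.

(** The exponents that write [gaugeA v] as a [pow_tensor] over [gauge_basis]. *)
Definition incidence (v : vertex L) (a : Q + edge E) : nat :=
  match a with inl q => q == val v | inr e => v \in val e end.

Lemma gaugeAE v : gaugeA U E v = pow_tensor gauge_basis (incidence v).
Proof.
rewrite /gaugeA -[basisX _]expr1 (site_pow_tensor gauge_basis (inl (val v))).
under eq_bigr do rewrite -[mxX C]expr1 (site_pow_tensor gauge_basis (inr _)).
rewrite pow_tensor_prod -/(GRing.mul _ _).
rewrite [LHS]pow_tensorM; apply: eq_pow_tensor => -[q|e] /=.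
  by rewrite big1 ?addn0 ?muln1 // => e _; rewrite muln1.
rewrite mul0n add0n.
under eq_bigr do rewrite muln1 (inj_eq inr_inj).
exact: sum_eq_pred.
Qed.

(** Exponents add, and their parities suffice because each [basisX (U q)] is an involution. *)
Lemma vertexXM c1 c2 :
  vertexX c1 * vertexX c2 = vertexX [ffun v => c1 v (+) c2 v].
Proof.
rewrite pow_tensorM; apply: eq_odd_pow_tensor => q.
  by apply/basisX_sqr/hU.1.
rewrite oddD !(big_morph odd oddD (erefl _)) -big_split /=.
by apply: eq_bigr => v _; rewrite !oddM !oddb ffunE andb_addl.
Qed.

Lemma vertexX_full : vertexX [ffun => true] = pauli_op_mx C L.
Proof.
rewrite hU.2.
under eq_bigr do
  rewrite -[basisX _]expr1 (site_pow_tensor (fun q => basisX (U q))).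
rewrite pow_tensor_prod; apply: eq_pow_tensor => q.
under [RHS]eq_bigr do rewrite muln1.
rewrite sum_eq_pred; under eq_bigr do rewrite ffunE mul1n.
(* A qubit of the support comes from exactly one vertex, any other qubit from none. *)
case: (insubP (vertex L) q) => [u -> <-|/negPf qL].
  by under eq_bigr do rewrite (inj_eq val_inj); rewrite sum_eq_pred.
rewrite qL big1 // => v _.
by case: eqP => // qv; rewrite qv (valP v) in qL.
Qed.

(** Every edge is measured exactly once, so each edge factor is a single projector. *)
Lemma prod_edgeZ (es : seq (edge E)) omega : perm_eq es (enum (edge E)) ->
  \prod_(e <- rev es) eigenproj (edgeZ C e) (omega e) =
  tensor (fun a => if a is inr e then eigenproj (mxZ C) (omega e) else 1).
Proof.
move=> hes; under eq_bigr do rewrite eigenproj_site.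
rewrite tensor_prod; apply: eq_tensor => -[q|e] /=; first by rewrite big1.
have uniq_es : uniq (rev es) by rewrite rev_uniq (perm_uniq hes) enum_uniq.
have mem_es : e \in rev es by rewrite mem_rev (perm_mem hes) mem_enum.
under eq_bigr do rewrite (inj_eq inr_inj) eq_sym.
by rewrite -big_mkcond -big_filter filter_pred1_uniq // big_seq1.
Qed.

(** The basis label left on the edge qubits by the outcomes [omega]: outcome +1, encoded [false], is
    bit 0. *)
Definition edge_bits omega : bits (edge E) :=
  [ffun e : edge E => inord (omega e)].

(** The term [c] of the expanded vertex projectors sends the edge qubits from zero to the basis
    state [coboundary c], which the edge projectors annihilate unless it is [omega]. The edges thus
    factor out as a basis state. *)
Lemma gauged_state (vs : seq (vertex L)) (es : seq (edge E)) psi eps omega x w :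
    perm_eq vs (enum (vertex L)) -> perm_eq es (enum (edge E)) ->
  ((\prod_(e <- rev es) eigenproj (edgeZ C e) (omega e))
    *m ((\prod_(v <- rev vs) eigenproj (gaugeA U E v) (eps v))
         *m adjoin0 (edge E) psi)) (index_of (join_bits x w)) 0
  = (2^-1 ^+ #|vertex L| *:
      \sum_(c | coboundary c == omega)
        (\prod_v sgn C (eps v && c v)) *: (vertexX c *m psi)) (index_of x) 0
    * (w == edge_bits omega)%:R.
Proof.
move=> hvs hes; rewrite prod_edgeZ //.
have hvs' : perm_eq (rev vs) (enum (vertex L)).
  by rewrite perm_rev.
rewrite (prod_eigenproj eps gaugeAE hvs').
rewrite -scalemxAl -scalemxAr mulmx_suml mulmx_sumr [LHS]mxE [in RHS]mxE -mulrA.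
congr (_ * _); rewrite !summxE mulr_suml [RHS]big_mkcond; apply: eq_bigr => c _.
rewrite -scalemxAl -scalemxAr [LHS]mxE.
rewrite mulmxA [X in X *m _]tensorM.
rewrite tensor_adjoin0.
have -> : \prod_(e : edge E) (eigenproj (mxZ C) (omega e)
      * gauge_basis (inr e) ^+ (\sum_v c v * incidence v (inr e))) (w e) 0
    = ((w == edge_bits omega) && (coboundary c == omega))%:R :> C.
  rewrite (eq_bigr (fun e : edge E =>
      ((w e == omega e :> nat) && (coboundary c e == omega e))%:R)) => [|e _].
    rewrite prodr_bool; congr (nat_of_bool _)%:R.
    apply/forallP/andP => [h|[/eqP-> /eqP<-] e].
      split; apply/eqP/ffunP => e; have /andP[/eqP we /eqP ce] := h e => //.
      by rewrite ffunE -we inord_val.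
    by rewrite ffunE inordK ?eqxx //; case: (coboundary c e).
  (* The edge projector is diagonal, so only the index [w e] contributes. *)
  rewrite [LHS]mxE (bigD1 (w e)) //=.
  rewrite [X in _ + X]big1 ?addr0 => [|k]; last first.
    by rewrite eigenprojZE eq_sym => /negPf ->; rewrite mul0r.
  rewrite eigenprojZE mxX_expE eqxx ffunE -natrM mulnb.
  congr (_%:R); case: eqP => // ->.
  by rewrite /=; case: (omega e); case: (odd _).
case: (coboundary c =P omega) => [_|_]; last by rewrite andbF !mulr0.
rewrite [in RHS]mxE andbT -mulrA; congr (_ * (_ * _)).
congr ((_ *m _) _ _); apply: eq_tensor => q.
by rewrite mul1r.
Qed.

End Gauging.

(** * Signs as booleans *)

Section Sgn.
Context (C : numClosedFieldType).

Lemma sgnD a b : sgn C (a (+) b) = sgn C a * sgn C b.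
Proof. exact: signr_addb. Qed.

Lemma prod_sgn K (r : seq K) (b : K -> bool) :
  \prod_(k <- r) sgn C (b k) = sgn C (\big[addb/false]_(k <- r) b k).
Proof. by rewrite (big_morph _ sgnD (erefl (sgn C false))). Qed.

Lemma sgn_eqN1 b : (sgn C b == -1) = b.
Proof.
rewrite -[-1]expr1 -[1%N]/(nat_of_bool true).
by rewrite (inj_eq (@signr_inj _)) eqb_id.
Qed.

Lemma sgn_inj : injective (sgn C).
Proof. by move=> a b e; rewrite -[a]sgn_eqN1 -[b]sgn_eqN1 e. Qed.

End Sgn.

(** * Cochains on the graph and the effect of the corrections *)

Section Correction.
Context (C : numClosedFieldType) (Q : finType) (L : pauli_op Q).
Context (U : Q -> 'M[C]_2) (E : {set {set vertex L}}).
Context (hU : adapted_basis L U) (hE : simple_graph E).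
Implicit Types (c eps : {ffun vertex L -> bool}).
Implicit Types (omega : {ffun edge E -> bool}).

Lemma vertexX0 : vertexX U [ffun v : vertex L => false] = 1.
Proof.
rewrite -tensor1; apply: eq_tensor => q.
by rewrite big1 // => v _; rewrite ffunE.
Qed.

Lemma coboundaryE c (e : edge E) u v :
  val e = [set u; v] -> coboundary E c e = c u (+) c v.
Proof.
(* Edges have two elements, so the end points are distinct and contribute one term each. *)
move=> eE; have uv : v != u.
  by have := hE (valP e); rewrite eE cards2 eq_sym; case: eqP.
rewrite ffunE eE (bigD1 u) //= (bigD1 v) //= big1 => [|w /andP[wu wv]].
  by rewrite !inE !eqxx orbT !muln1 addn0 oddD !oddb.
by rewrite !inE (negPf wu) (negPf wv) muln0.
Qed.

Lemma coboundaryN c : coboundary E [ffun v => ~~ c v] = coboundary E c.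
Proof.
apply/ffunP => e; have /eqP/cards2P[u [v [_ eE]]] := hE (valP e).
by rewrite !(coboundaryE _ eE) !ffunE addNb addbN negbK.
Qed.

(** The sum telescopes: each intermediate vertex occurs twice and cancels mod 2. *)
Lemma edge_path_coboundary c u g w : edge_path (E := E) u g w ->
  \big[addb/false]_(e <- g) coboundary E c e = c u (+) c w.
Proof.
elim: g u => [|e g IHg] u /= => [/eqP->|/existsP[u' /andP[/eqP eE gw]]].
  by rewrite big_nil addbb.
by rewrite big_cons (IHg _ gw) (coboundaryE c eE) -addbA addKb.
Qed.

(** Along the paths from [v0] the coboundary determines [c v0 (+) c v], so only the value of [c] at
    [v0] remains free. *)
Lemma coboundary_fiber c c0 v0 (gamma : vertex L -> seq (edge E)) :
  (forall v, edge_path v0 (gamma v) v) ->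
  coboundary E c = coboundary E c0 -> c = c0 \/ c = [ffun v => ~~ c0 v].
Proof.
move=> hg ec.
have cE v : c v0 (+) c v = c0 v0 (+) c0 v.
  by rewrite -!(edge_path_coboundary _ (hg v)) ec.
have [e0|ne0] := eqVneq (c v0) (c0 v0).
  by left; apply/ffunP => v; apply: (@addbI (c v0)); rewrite cE e0.
right; apply/ffunP => v; rewrite ffunE; have := cE v; move: ne0.
by case: (c v0) (c0 v0) (c v) (c0 v) => [] [] [] [].
Qed.

Lemma sum_coboundary_fiber (V : nmodType) c0 v0
    (gamma : vertex L -> seq (edge E))
    (F : {ffun vertex L -> bool} -> V) :
  (forall v, edge_path v0 (gamma v) v) ->
  \sum_(c | coboundary E c == coboundary E c0) F c
    = F c0 + F [ffun v => ~~ c0 v].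
Proof.
move=> hg; have neq : [ffun v => ~~ c0 v] != c0.
  by apply/eqP => /ffunP/(_ v0); rewrite ffunE; case: (c0 v0).
rewrite (bigD1 c0) //= (bigD1 [ffun v => ~~ c0 v]) /= ?coboundaryN ?eqxx //.
rewrite big1 ?addr0 // => c /andP[/andP[/eqP ec /eqP n1] /eqP n2].
by case: (coboundary_fiber hg ec).
Qed.

Lemma correct_density (ws : seq (vertex L)) omega gamma
    (psi : 'cV[C]_(hdim Q)) :
  perm_eq ws (enum (vertex L)) ->
  correct U ws omega gamma (density psi) =
  density
    (vertexX U [ffun v => \prod_(e <- gamma v) sgn C (omega e) == -1] *m psi).
Proof.
move=> hws; set b := [ffun v => _].
(* The conditional correction becomes a conjugation by a power 0 or 1, so that the corrections form
   one product. *)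
have -> : correct U ws omega gamma (density psi) =
    foldl (fun rho v =>
        conjugate (site (val v) (basisX (U (val v)) ^+ b v)) rho)
      (density psi) ws.
  rewrite /correct; elim: ws (density psi) {hws} => //= v ws IHws rho.
  rewrite IHws ffunE; congr foldl; case: ifP => _ //.
  by rewrite expr0 site1 /conjugate mul1mx trmx1 map_mx1 mulmx1.
rewrite foldl_conjugate.
under eq_bigr do rewrite (site_pow_tensor (fun q => basisX (U q))).
rewrite pow_tensor_prod; congr (density (_ *m _)); apply: eq_pow_tensor => q.
rewrite (perm_big _ (_ : perm_eq _ (enum (vertex L)))) ?perm_rev //=.
by rewrite big_enum; apply: eq_bigr => v _; rewrite mulnC.
Qed.

Lemma gauging_outputE (vs ws : seq (vertex L)) (es : seq (edge E))
    psi eps omega gamma :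
    perm_eq vs (enum (vertex L)) -> perm_eq ws (enum (vertex L)) ->
    perm_eq es (enum (edge E)) ->
  gauging_output U vs ws es psi eps omega gamma =
  density (vertexX U [ffun v => \prod_(e <- gamma v) sgn C (omega e) == -1] *m
    (2^-1 ^+ #|vertex L| *: \sum_(c | coboundary E c == omega)
        (\prod_v sgn C (eps v && c v)) *: (vertexX U c *m psi))).
Proof.
move=> hvs hws hes; rewrite /gauging_output !measure_seq_density.
rewrite (discard_density (fun x w => gauged_state U psi eps omega x w hvs hes)).
exact: correct_density.
Qed.

(** The amplitude collects [2^-1] for each vertex projector, and a 2 from rewriting 1 + sigma L as
    twice an eigenprojector; passing to the density squares it. *)
Lemma gauging_output_coboundary v0 (vs ws : seq (vertex L)) (es : seq (edge E))
    psi eps c gamma sigma :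
    perm_eq vs (enum (vertex L)) -> perm_eq ws (enum (vertex L)) ->
    perm_eq es (enum (edge E)) -> (forall v, edge_path v0 (gamma v) v) ->
    gauging_sign C eps = sgn C sigma ->
  gauging_output U vs ws es psi eps (coboundary E c) gamma =
  (2^-1 ^+ #|vertex L| * 2) ^+ 2 *:
    density (eigenproj (pauli_op_mx C L) sigma *m psi).
Proof.
move=> hvs hws hes hg epsE; rewrite gauging_outputE //.
(* The correction read off the paths: [c] itself or its complement, according to [c v0]. *)
pose b := [ffun v => c v0 (+) c v].
have -> : [ffun v => \prod_(e <- gamma v) sgn C (coboundary E c e) == -1] = b.
  apply/ffunP => v; rewrite !ffunE prod_sgn sgn_eqN1.
  by rewrite (edge_path_coboundary _ (hg v)).
(* Taking [b] as representative of the fiber makes the correction cancel the first of the two terms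
   exactly and turn the second into L. *)
have <- : coboundary E b = coboundary E c.
  have [->|->] : b = c \/ b = [ffun v => ~~ c v]; rewrite ?coboundaryN //.
  by rewrite /b; case: (c v0); [right|left]; apply/ffunP => v; rewrite !ffunE.
rewrite (sum_coboundary_fiber _ _ hg).
set a := \prod_v sgn C (eps v && b v).
have -> : \prod_v sgn C (eps v && [ffun v => ~~ b v] v) = a * sgn C sigma.
  rewrite -epsE /a /gauging_sign -big_split /=; apply: eq_bigr => v _.
  by rewrite -sgnD ffunE; case: (eps v) (b v) => [] [].
(* The sign [a] is a global phase, invisible in the density matrix. *)
have a1 : `|a| = 1 by rewrite normr_prod big1 // => v _; rewrite normr_sign.
have bb : vertexX U b *m vertexX U b = 1%:M.
  rewrite -[RHS]vertexX0 -[LHS]/(_ * _) (vertexXM hU); congr vertexX.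
  by apply/ffunP => v; rewrite !ffunE addbb.
have bNb : vertexX U b *m vertexX U [ffun v => ~~ b v] = pauli_op_mx C L.
  rewrite -(vertexX_full hU) -[LHS]/(_ * _) (vertexXM hU); congr vertexX.
  by apply/ffunP => v; rewrite !ffunE addbN addbb.
have -> : vertexX U b *m (2^-1 ^+ #|vertex L| *:
      (a *: (vertexX U b *m psi)
       + a * sgn C sigma *: (vertexX U [ffun v => ~~ b v] *m psi))) =
    (2^-1 ^+ #|vertex L| * 2 * a) *: (eigenproj (pauli_op_mx C L) sigma *m psi).
  rewrite -scalemxAr mulmxDr -!scalemxAr !mulmxA bb bNb /eigenproj.
  move: (pauli_op_mx C L) => Lm; rewrite -!scalemxAl mulmxDl -scalemxAl !mul1mx.
  rewrite [RHS]scalerA -[_ / 2]mulrA [a / 2]mulrC mulrA mulfK ?pnatr_eq0 //.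
  by rewrite -!scalerA !scalerDr.
rewrite densityZ normrM a1 mulr1 ger0_norm // mulr_ge0 ?ler0n // exprn_ge0 //.
by rewrite invr_ge0 ler0n.
Qed.

Lemma gauging_output_not_coboundary (vs ws : seq (vertex L)) (es : seq (edge E))
    psi eps omega gamma :
    perm_eq vs (enum (vertex L)) -> perm_eq ws (enum (vertex L)) ->
    perm_eq es (enum (edge E)) -> (forall c, coboundary E c != omega) ->
  gauging_output U vs ws es psi eps omega gamma = 0.
Proof.
move=> hvs hws hes nc; rewrite gauging_outputE // big1 => [|c cE].
  by rewrite scaler0 mulmx0 /density mul0mx.
by have := nc c; rewrite cE.
Qed.

(** Flipping the outcome at [v0] exchanges the two signs, so each accounts for half of the
    assignments. *)
Lemma sum_gauging_sign sigma (v0 : vertex L) :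
  (\sum_(eps | gauging_sign C (L := L) eps == sgn C sigma) 1) * 2
    = 2 ^+ #|vertex L| :> C.
Proof.
pose S b : C := \sum_(eps | gauging_sign C (L := L) eps == sgn C b) 1.
pose flip (eps : {ffun vertex L -> bool}) := [ffun v => eps v (+) (v == v0)].
have flipK : involutive flip.
  by move=> eps; apply/ffunP => v; rewrite !ffunE addbK.
have sgn_flip eps : gauging_sign C (flip eps) = gauging_sign C eps * sgn C true.
  rewrite /gauging_sign; under eq_bigr do rewrite ffunE sgnD.
  rewrite big_split; congr (_ * _); rewrite (bigD1 v0) //= eqxx big1 ?mulr1 //.
  by move=> v /negPf ->.
have SN b : S b = S (~~ b).
  rewrite /S (reindex_inj (inv_inj flipK)); apply: eq_bigl => eps.
  by rewrite sgn_flip -[~~ b]addbT sgnD; apply/eqP/eqP => [<-|->];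
    rewrite -mulrA -sgnD mulr1.
have signP eps : {b | gauging_sign C eps = sgn C b}.
  rewrite /gauging_sign; elim/big_ind: _ => [|_ _ [a ->] [b ->]|v _].
  - by exists false.
  - by exists (a (+) b); rewrite sgnD.
  - by exists (eps v).
rewrite -/(S sigma) mulr_natr mulr2n {2}SN.
have -> : S sigma + S (~~ sigma) = \sum_(eps : {ffun vertex L -> bool}) 1.
  rewrite [RHS](bigID (fun eps => gauging_sign C eps == sgn C sigma)) /=.
  congr (_ + _); apply: eq_bigl => eps; have [b ->] := signP eps.
  by rewrite !(inj_eq (@sgn_inj C)); case: b sigma => [] [].
by rewrite sumr_const card_ffun card_bool natrX.
Qed.

End Correction.

End Lemmas.

(** * Outcome probabilities and the post-measurement state *)

Theorem theorem1 (C : numClosedFieldType) (Q I : finType)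
    (s : I -> pauli_op Q) (L : pauli_op Q) (U : Q -> 'M[C]_2)
    (E : {set {set vertex L}}) (v0 : vertex L) (psi : 'cV[C]_(hdim Q))
    (vs ws : seq (vertex L)) (es : seq (edge E))
    (gamma : {ffun vertex L -> bool} -> {ffun edge E -> bool} ->
             vertex L -> seq (edge E))
    (hs : stabilizer_checks C s)
    (hL : logical_op C s L)
    (hU : adapted_basis L U)
    (hE : simple_graph E)
    (hG : connected_graph E)
    (hpsi : code_vector s psi)
    (hpsi1 : norm2 psi = 1)
    (hvs : perm_eq vs (enum (vertex L)))
    (hws : perm_eq ws (enum (vertex L)))
    (hes : perm_eq es (enum (edge E)))
    (hgamma : forall eps omega v, edge_path v0 (gamma eps omega v) v) :
  let out eps omega :=
    gauging_output U vs ws es psi eps omega (gamma eps omega) in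
  let post (sigma : bool) := eigenproj (pauli_op_mx C L) sigma *m psi in
  forall sigma : bool,
    [/\ \sum_(eps | gauging_sign C eps == sgn C sigma) \sum_omega
          \tr (out eps omega) = norm2 (post sigma),
        forall eps omega,
          gauging_sign C eps = sgn C sigma -> \tr (out eps omega) != 0 ->
          (\tr (out eps omega))^-1 *: out eps omega
            = (norm2 (post sigma))^-1 *: density (post sigma)
      & code_vector s (post sigma)].
Proof.
move=> out post sigma; set n := #|vertex L|.
have outE eps c : gauging_sign C eps = sgn C sigma ->
    out eps (coboundary E c)
      = (2^-1 ^+ n * 2) ^+ 2 *: density (post sigma).
  move=> epsE.
  exact: (gauging_output_coboundary hU hE psi c hvs hws hes (hgamma _ _) epsE).
have out0 eps omega : (forall c, coboundary E c != omega) -> out eps omega = 0.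
  by move=> nc; apply: gauging_output_not_coboundary.
have two_unit : (2 : C) != 0 by rewrite pnatr_eq0.
have k_neq0 : (2^-1 ^+ n * 2) ^+ 2 != 0 :> C.
  by rewrite expf_neq0 // mulf_neq0 // expf_neq0 // invr_eq0.
have imP (omega : {ffun edge E -> bool}) :
    (exists c, coboundary E c = omega) \/ (forall c, coboundary E c != omega).
  have [/existsP[c /eqP cE]|/existsPn nc] :=
    boolP [exists c, coboundary E c == omega]; by [left; exists c|right].
split.
(* The indicator that [omega] is a coboundary is half the size of its fiber; this turns the sum over
   [omega] into a count of cochains. *)
- have trE eps omega : gauging_sign C eps = sgn C sigma ->
      \tr (out eps omega) * 2 = (2^-1 ^+ n * 2) ^+ 2 * norm2 (post sigma)
        * \sum_(c | coboundary E c == omega) 1.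
    move=> epsE; have [[c <-]|nc] := imP omega.
      rewrite outE // mxtraceZ trace_density.
      by rewrite (sum_coboundary_fiber hE c (fun=> 1)
        (hgamma eps (coboundary E c))).
    rewrite out0 // mxtrace0 mul0r big1 ?mulr0 // => c /eqP cE.
    by have := nc c; rewrite cE eqxx.
  have -> : \sum_(eps | gauging_sign C eps == sgn C sigma)
      \sum_omega \tr (out eps omega) =
      (\sum_(eps : {ffun vertex L -> bool} |
         gauging_sign C eps == sgn C sigma) 1)
      * ((2^-1 ^+ n * 2) ^+ 2 * norm2 (post sigma) * 2 ^+ n / 2).
    rewrite mulr_suml; apply: eq_bigr => eps /eqP epsE; rewrite mul1r.
    apply: (mulIf two_unit); rewrite mulfVK // mulr_suml.
    under eq_bigr do rewrite trE //.
    rewrite -mulr_sumr; congr (_ * _).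
    (* The fibers of the coboundary map partition all [2 ^+ n] cochains. *)
    transitivity (\sum_(c : {ffun vertex L -> bool}) (1 : C)).
      by rewrite [RHS](partition_big (coboundary E) predT).
    by rewrite sumr_const card_ffun card_bool natrX.
  have -> : \sum_(eps : {ffun vertex L -> bool} |
      gauging_sign C eps == sgn C sigma) 1
      = 2 ^+ n / 2 :> C.
    by rewrite -(sum_gauging_sign C sigma v0) mulfK.
  have : 2 ^+ n != 0 :> C by rewrite expf_neq0.
  (* The two counts [P / 2] cancel the weight [(2 / P) ^+ 2]. *)
  by rewrite exprVn; move: (2 ^+ n) (norm2 _) => P t P0; field.
(* Nonzero trace forces [omega] to be a coboundary; the common weight then cancels on
   normalization. *)
- move=> eps omega epsE; have [[c <-]|/out0 ->] := imP omega; last first.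
    by rewrite mxtrace0 eqxx.
  rewrite outE // mxtraceZ trace_density => _.
  by rewrite scalerA invfM mulrAC mulVf // mul1r.
(* Each check commutes with L, hence with its eigenprojector, and fixes [psi]. *)
- move=> i; have := hL i; have := hpsi i; rewrite /post /eigenproj /comm_mx.
  move: (pauli_op_mx C (s i)) (pauli_op_mx C L) => A B Apsi BA.
  rewrite mulmxA -scalemxAr mulmxDr mulmx1 -scalemxAr -BA.
  by rewrite -!scalemxAl !mulmxDl -!scalemxAl mul1mx -mulmxA Apsi.
Qed.
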